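(* Let $\phi=\tilde p/p$ be a rational inner function on $\mathbb{D}^2$ with $\deg\phi=(m,n)$ and a singularity on $\mathbb{T}^2$ with $z_2$-coordinate $\tau_2$. Then there exist a rational number $K>0$, constants $0<c\le C$, and a neighborhood $U\subseteq\mathbb{T}$ of $\tau_2$ such that $c|\tau_2-\zeta_2|^K\le \epsilon(\phi,\zeta_2)\le C|\tau_2-\zeta_2|^K$ for all $\zeta_2\in U$.
   Context: $\phi=\tilde p/p$ where $p\in\mathbb{C}[z_1,z_2]$ has bidegree $(m,n)$, no zeros in $\mathbb{D}^2$, is atoral (finitely many zeros on $\mathbb{T}^2$, no common factor with $\tilde p$), and $\tilde p(z)=z_1^mz_2^n\overline{p(1/\bar z_1,1/\bar z_2)}$. A singularity of $\phi$ is a zero of $p$ on $\mathbb{T}^2$. For $\zeta_2\in\mathbb{T}$ not the $z_2$-coordinate of a singularity, $\epsilon(\phi,\zeta_2)=\min\{1-|z_1|:\tilde p(z_1,\zeta_2)=0\}$; otherwise $\epsilon(\phi,\zeta_2)=0$. *)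

(* Defs.v *)
From Stdlib Require Import Reals Lra ClassicalEpsilon.
Open Scope R_scope.

Definition Cx := (R * R)%type.
Definition Cre (z : Cx) : R := fst z.
Definition Cim (z : Cx) : R := snd z.
Definition C0 : Cx := (0, 0).
Definition C1 : Cx := (1, 0).
Definition Cadd (z w : Cx) : Cx := (Cre z + Cre w, Cim z + Cim w).
Definition Csub (z w : Cx) : Cx := (Cre z - Cre w, Cim z - Cim w).
Definition Cmul (z w : Cx) : Cx :=
  (Cre z * Cre w - Cim z * Cim w, Cre z * Cim w + Cim z * Cre w).
Definition Cconj (z : Cx) : Cx := (Cre z, - Cim z).
Fixpoint Cpow (z : Cx) (k : nat) : Cx :=
  match k with O => C1 | S k' => Cmul z (Cpow z k') end.
Definition Cmod (z : Cx) : R := sqrt (Cre z ^ 2 + Cim z ^ 2).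

(* A polynomial of bidegree at most (d1,d2) is given by its coefficient
   function a : nat -> nat -> Cx (coefficient of z1^i z2^j is a i j);
   only the coefficients with i <= d1, j <= d2 are used. *)
Definition coef2 := nat -> nat -> Cx.

Fixpoint Csum (k : nat) (f : nat -> Cx) : Cx :=
  match k with O => f O | S k' => Cadd (Csum k' f) (f k) end.

Definition peval (d1 d2 : nat) (a : coef2) (z1 z2 : Cx) : Cx :=
  Csum d1 (fun i => Csum d2 (fun j =>
     Cmul (a i j) (Cmul (Cpow z1 i) (Cpow z2 j)))).

Definition has_bidegree (m n : nat) (a : coef2) : Prop :=
  (forall i j, (m < i)%nat \/ (n < j)%nat -> a i j = C0) /\
  (exists j, a m j <> C0) /\ (exists i, a i n <> C0).

(* reflection: ptilde(z) = z1^m z2^n conj(p(1/conj z1, 1/conj z2)),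
   whose coefficients are conj(a (m-i) (n-j)) for i <= m, j <= n. *)
Definition reflect2 (m n : nat) (a : coef2) : coef2 :=
  fun i j => Cconj (a (m - i)%nat (n - j)%nat).

Definition no_zeros_in_bidisk (m n : nat) (a : coef2) : Prop :=
  forall z1 z2, Cmod z1 < 1 -> Cmod z2 < 1 -> peval m n a z1 z2 <> C0.

Definition finitely_many_torus_zeros (m n : nat) (a : coef2) : Prop :=
  exists L : list (Cx * Cx), forall z1 z2, Cmod z1 = 1 -> Cmod z2 = 1 ->
     peval m n a z1 z2 = C0 -> List.In (z1, z2) L.

Definition no_common_factor (m n : nat) (a b : coef2) : Prop :=
  forall (dq1 dq2 dr1 dr2 ds1 ds2 : nat) (q r s : coef2),
    (forall z1 z2, peval m n a z1 z2 =
        Cmul (peval dq1 dq2 q z1 z2) (peval dr1 dr2 r z1 z2)) ->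
    (forall z1 z2, peval m n b z1 z2 =
        Cmul (peval dq1 dq2 q z1 z2) (peval ds1 ds2 s z1 z2)) ->
    forall z1 z2 w1 w2, peval dq1 dq2 q z1 z2 = peval dq1 dq2 q w1 w2.

Definition atoral (m n : nat) (a : coef2) : Prop :=
  finitely_many_torus_zeros m n a /\ no_common_factor m n a (reflect2 m n a).

(* z2-coordinate of a singularity of phi = ptilde/p (a zero of p on T^2) *)
Definition is_sing_z2 (m n : nat) (a : coef2) (t2 : Cx) : Prop :=
  Cmod t2 = 1 /\ exists t1, Cmod t1 = 1 /\ peval m n a t1 t2 = C0.

Definition is_min_eps (m n : nat) (a : coef2) (zeta2 : Cx) (e : R) : Prop :=
  (exists z1, peval m n (reflect2 m n a) z1 zeta2 = C0 /\ e = 1 - Cmod z1) /\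
  (forall z1, peval m n (reflect2 m n a) z1 zeta2 = C0 -> e <= 1 - Cmod z1).

(* epsilon(phi, zeta2); the value is unspecified when the minimum does not exist *)
Definition eps_phi (m n : nat) (a : coef2) (zeta2 : Cx) : R :=
  epsilon (inhabits 0) (fun e =>
    (is_sing_z2 m n a zeta2 /\ e = 0) \/
    (~ is_sing_z2 m n a zeta2 /\ is_min_eps m n a zeta2 e)).

(* x^K for x >= 0 and real K > 0, with 0^K = 0 *)
Definition rpow (x K : R) : R := if Rle_dec x 0 then 0 else Rpower x K.

(* Main.v *)
(** For [w] on the unit circle let [z_1, ..., z_m] be the zeros of the reflected
    polynomial at [w]; they lie in the closed disk and there are exactly [m] of
    them, because [p] has no zeros on the disk times the circle (a Harnack
    estimate for zero-free polynomials, followed by a radial limit).  The smallest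
    modulus among the numbers [1 - z_j * conj z_k] is [1 - (max |z_j|)^2], which is
    comparable to the distance [eps] of the zeros to the circle.  These numbers
    are the roots in [s] of a polynomial whose coefficients [r_k] are polynomials
    in [w]: plug the companion matrix of the reflection at [w] into the
    homogenisation of [p] and take the determinant.  The smallest root modulus is
    comparable to [min_k |r_0 / r_k|^(1/k)], and [|r_k|] is comparable to
    [|w - tau|] to the power of the order of vanishing of [r_k] at [tau].  Hence
    [eps] is comparable to a rational power of [|w - tau|], the same one on both
    sides of [tau], without any appeal to Puiseux series. *)

Require Import Defs.
From Stdlib Require Import Reals Lra ClassicalEpsilon.
Open Scope R_scope.

Module ClosestZero.

From mathcomp Require Import all_boot all_order all_algebra ring.
From mathcomp Require Import complex Rstruct.

Set Implicit Arguments.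
Unset Strict Implicit.
Unset Printing Implicit Defensive.

Import Order.TTheory GRing.Theory Num.Theory.
Local Open Scope ring_scope.

(** * Size of a one-variable polynomial near a point *)

Lemma poly_bounded_unit_disk (C : numClosedFieldType) (q : {poly C}) :
  exists2 B : C, 1 <= B & forall z, `|z| <= 1 -> `|q.[z]| <= B.
Proof.
exists (1 + \sum_(i < size q) `|q`_i|); first by rewrite lerDl sumr_ge0.
move=> z z1; rewrite horner_coef (le_trans (ler_norm_sum _ _ _)) //.
rewrite (@le_trans _ _ (\sum_(i < size q) `|q`_i|)) ?lerDr //.
apply: ler_sum => i _; rewrite normrM normrX ler_piMr //.
by rewrite exprn_ile1.
Qed.

Lemma horner_subr_factor (C : numClosedFieldType) (q : {poly C}) (t : C) :
  exists g : {poly C}, forall w, q.[w] - q.[t] = g.[w] * (w - t).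
Proof.
have /factor_theorem [g Hg] : root (q - q.[t]%:P) t.
  by rewrite rootE !hornerE subrr.
by exists g => w; have /(congr1 (horner^~ w)) := Hg; rewrite !hornerE.
Qed.

(** Writing [q.[w] - q.[t] = g.[w] * (w - t)] with [g] bounded on the disk gives an explicit radius
    on which [q] keeps at least half of [|q.[t]|]. *)
Lemma poly_lower_bound_near (C : numClosedFieldType) (q : {poly C}) (t : C) :
  ~~ root q t -> exists2 B : C, 1 <= B &
  forall w, `|w| <= 1 -> `|w - t| < B^-1 -> 1 <= B * `|q.[w]|.
Proof.
move=> qt; have [g Hg] := horner_subr_factor q t.
have [G G1 HG] := poly_bounded_unit_disk g.
have q0 : 0 < `|q.[t]| by rewrite normr_gt0.
have G0 : 0 < G by exact: lt_le_trans G1.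
(* The second term makes [G / B] at most half of [|q.[t]|]; the third makes [B] times that half at
   least 1. *)
exists (1 + 2 * G / `|q.[t]| + 2 / `|q.[t]|).
  by rewrite -addrA lerDl addr_ge0 // divr_ge0 // mulr_ge0 // ltW.
set B := (1 + _ + _) => w w1 wt.
have B0 : 0 < B by rewrite !addr_gt0 // divr_gt0 // mulr_gt0.
have h1 : `|q.[w] - q.[t]| <= `|q.[t]| / 2.
  rewrite Hg normrM (@le_trans _ _ (G * B^-1)) //.
    by rewrite ler_pM ?HG // ltW.
  have -> : `|q.[t]| / 2 = (`|q.[t]| * B / 2) / B by rewrite mulrAC mulfK ?gt_eqF.
  rewrite ler_pM2r ?invr_gt0 // ler_pdivlMr //.
  have -> : `|q.[t]| * B = G * 2 + (`|q.[t]| + 2).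
    by rewrite /B; field; rewrite gt_eqF.
  by rewrite lerDl addr_ge0.
have h2 : `|q.[t]| / 2 <= `|q.[w]|.
  have := ler_normB q.[w] (q.[w] - q.[t]).
  rewrite opprB addrC subrK => h3.
  have : `|q.[t]| <= `|q.[w]| + `|q.[t]| / 2 by rewrite (le_trans h3) // lerD2l.
  by rewrite -lerBlDr {1}[`|q.[t]|]splitr addrK.
apply: le_trans (_ : B * (`|q.[t]| / 2) <= _); last by rewrite ler_pM2l.
rewrite (@le_trans _ _ (2 / `|q.[t]| * (`|q.[t]| / 2))) //.
  by rewrite mulrA divfK ?gt_eqF // divff ?pnatr_eq0.
rewrite ler_pM2r ?divr_gt0 // lerDr addr_ge0 // divr_ge0 // mulr_ge0 // ltW //.
Qed.

(* A single constant [B] that may be enlarged serves as both comparison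
   constant and (inverted) radius, so that finite families need no minima. *)
Lemma poly_comparable_near (C : numClosedFieldType) (q : {poly C}) (t : C) :
  q != 0 -> exists2 B : C, 1 <= B &
  forall w, `|w| <= 1 -> `|w - t| < B^-1 ->
    `|w - t| ^+ mup t q <= B * `|q.[w]| /\ `|q.[w]| <= B * `|w - t| ^+ mup t q.
Proof.
move=> q0; have [k [g]] := multiplicity_XsubC q t; rewrite q0 => /= gt Eq.
have -> : mup t q = k by rewrite Eq mupMr // mup_XsubCX eqxx.
have [B1 B11 H1] := poly_bounded_unit_disk g.
have [B2 B21 H2] := poly_lower_bound_near gt.
have B10 : 0 < B1 by exact: lt_le_trans B11.
have B20 : 0 < B2 by exact: lt_le_trans B21.
exists (B1 + B2) => [|w w1 wt]; first by rewrite (le_trans B11) // lerDl ltW.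
have wt2 : `|w - t| < B2^-1.
  by rewrite (lt_le_trans wt) // lef_pV2 ?posrE ?addr_gt0 // lerDr ltW.
rewrite Eq !hornerE normrM normrX; split.
  rewrite mulrA ler_peMl ?exprn_ge0 //.
  by rewrite (le_trans (H2 _ w1 wt2)) // ler_wpM2r // lerDr ltW.
by rewrite ler_wpM2r ?exprn_ge0 // (le_trans (H1 _ w1)) // lerDl ltW.
Qed.

Lemma polys_comparable_near (C : numClosedFieldType) (s : seq {poly C}) (t : C) :
  exists2 B : C, 1 <= B &
  forall q w, q \in s -> q != 0 -> `|w| <= 1 -> `|w - t| < B^-1 ->
    `|w - t| ^+ mup t q <= B * `|q.[w]| /\ `|q.[w]| <= B * `|w - t| ^+ mup t q.
Proof.
elim: s => [|q s [B1 B11 IH]]; first by exists 1.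
have B10 : 0 < B1 by exact: lt_le_trans B11.
have [->|q0] := eqVneq q 0.
  exists B1 => // p w; rewrite inE => /orP[/eqP ->|]; first by rewrite eqxx.
  exact: IH.
have [B2 B21 H2] := poly_comparable_near t q0.
have B20 : 0 < B2 by exact: lt_le_trans B21.
have weaken B p w : 0 < B -> B <= B1 + B2 ->
   (`|w - t| < B^-1 -> `|w - t| ^+ mup t p <= B * `|p.[w]| /\
     `|p.[w]| <= B * `|w - t| ^+ mup t p) ->
   `|w - t| < (B1 + B2)^-1 -> `|w - t| ^+ mup t p <= (B1 + B2) * `|p.[w]| /\
     `|p.[w]| <= (B1 + B2) * `|w - t| ^+ mup t p.
  move=> B0 BB H wt; case: H => [|h1 h2].
    by rewrite (lt_le_trans wt) // lef_pV2 ?posrE ?addr_gt0.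
  split; first by rewrite (le_trans h1) // ler_wpM2r.
  by rewrite (le_trans h2) // ler_wpM2r ?exprn_ge0.
exists (B1 + B2) => [|p w]; first by rewrite (le_trans B11) // lerDl ltW.
rewrite inE => /orP[/eqP ->|ps] p0 w1.
  by apply: (weaken _ _ _ B20) => [|wt]; [rewrite lerDr ltW | exact: H2].
by apply: (weaken _ _ _ B10) => [|wt]; [rewrite lerDl ltW | exact: IH].
Qed.

(** * Coefficients against the smallest root modulus *)

(** By Vieta the coefficient is a signed sum of products of all roots but [k]. The factor [mu ^+ k]
    stands in for the missing roots, and there are at most [2 ^+ size s] products. The induction
    adds one root at a time, doubling the bound. *)
Lemma coef_prod_XsubC_bound (C : numClosedFieldType) (s : seq C) (mu : C) k :
  0 <= mu -> (forall b, b \in s -> mu <= `|b|) ->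
  `|(\prod_(b <- s) ('X - b%:P))`_k| * mu ^+ k <=
    2 ^+ size s * `|(\prod_(b <- s) ('X - b%:P))`_0|.
Proof.
move=> mu0; elim: s k => [|b s IH] k Hs.
  rewrite !big_nil /= expr0 mul1r !coefC; case: k => [|k] /=.
    by rewrite mulr1.
  by rewrite normr0 mul0r.
have {}IH j : `|(\prod_(b <- s) ('X - b%:P))`_j| * mu ^+ j <=
    2 ^+ size s * `|(\prod_(b <- s) ('X - b%:P))`_0|.
  by apply: IH => c cs; apply: Hs; rewrite inE cs orbT.
have mb : mu <= `|b| by apply: Hs; rewrite inE eqxx.
rewrite !big_cons mulrC [('X - _) * _]mulrC; move: IH.
set f := \prod_(_ <- _) _; rewrite !mulrBr !coefB !coefMX !coefMC.
move=> IH; rewrite eqxx sub0r normrN normrM /=.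
have IH' := IH k; case: k IH' => [|k] /= IHk.
  rewrite expr0 mul1r sub0r normrN normrM ler_peMl ?mulr_ge0 //.
  by rewrite exprn_ege1 // ler1n.
apply: le_trans (_ : mu ^+ k.+1 * (`|f`_k| + `|f`_k.+1| * `|b|) <= _).
  by rewrite ler_wpM2l ?exprn_ge0 // (le_trans (ler_normB _ _)) // normrM.
rewrite mulrDr [2 ^+ _]exprS mulr_natl mulr2n mulrDl; apply: lerD.
  rewrite exprS -mulrA [mu ^+ k * _]mulrC mulrA [X in _ <= X]mulrC.
  rewrite -mulrA [X in _ <= X]mulrAC [_ * `|b|]mulrC [`|f`_0| * _]mulrC.
  by rewrite ler_pM // mulr_ge0 ?exprn_ge0.
by rewrite mulrA [X in _ <= X]mulrA ler_wpM2r // mulrC.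
Qed.

Lemma coef_bound_of_roots (C : numClosedFieldType) (f : {poly C}) (mu : C) N k :
  0 <= mu -> (forall b, root f b -> mu <= `|b|) -> (size f <= N)%N ->
  `|f`_k| * mu ^+ k <= 2 ^+ N * `|f`_0|.
Proof.
move=> mu0 Hf fN; have [f0|f0] := eqVneq f 0.
  by rewrite f0 !coef0 normr0 mul0r mulr0.
have [s Es] := closed_field_poly_normal f.
have l0 : lead_coef f != 0 by rewrite lead_coef_eq0.
have Hs b : b \in s -> mu <= `|b|.
  by move=> bs; apply: Hf; rewrite Es rootZ // root_prod_XsubC.
have szs : (size s <= N)%N.
  apply: leq_trans (leqnSn _) (leq_trans _ fN).
  by rewrite [X in (_ <= size (polyseq X))%N]Es size_scale // size_prod_XsubC.
rewrite Es !coefZ !normrM -mulrA [X in _ <= X]mulrCA ler_wpM2l //.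
apply: le_trans (coef_prod_XsubC_bound k mu0 Hs) _.
by rewrite ler_wpM2r // ler_weXn2l // ler1n.
Qed.

(** At a root the constant term cancels the sum of the fewer than [N] other terms, so one of these
    must carry at least the share [1 / N] of it. *)
Lemma root_dominant_coef (C : numClosedFieldType) (f : {poly C}) (s : C) N :
  root f s -> f`_0 != 0 -> (size f <= N)%N ->
  exists2 k, (0 < k < N)%N & `|f`_0| <= N%:R * (`|f`_k| * `|s| ^+ k).
Proof.
case: N => [|N] fs f0 fN.
  by move: fN f0; rewrite leqn0 size_poly_eq0 => /eqP ->; rewrite coef0 eqxx.
case: (boolP [exists k : 'I_N, `|f`_0| <= N.+1%:R * (`|f`_k.+1| * `|s| ^+ k.+1)]).
  by case/existsP=> k Hk; exists k.+1 => //=; rewrite ltnS.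
rewrite negb_exists => /forallP Hk; exfalso.
have lt k : (k < N)%N -> N.+1%:R * (`|f`_k.+1| * `|s| ^+ k.+1) < `|f`_0|.
  move=> kN; rewrite real_ltNge ?(Hk (Ordinal kN)) //.
  by rewrite ger0_real // mulr_ge0 // mulr_ge0 // exprn_ge0.
move: fs; rewrite rootE (horner_coef_wide s fN) big_ord_recl /= expr0 mulr1.
rewrite addr_eq0 => /eqP E.
have : N.+1%:R * `|f`_0| <= N%:R * `|f`_0|.
  rewrite {1}E normrN.
  rewrite (le_trans (ler_wpM2l _ (ler_norm_sum _ _ _))) // mulr_sumr.
  have -> : N%:R * `|f`_0| = \sum_(i < N) `|f`_0|.
    by rewrite sumr_const card_ord mulr_natl.
  apply: ler_sum => i _; rewrite normrM normrX ltW //; exact: lt.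
by rewrite ler_pM2r ?normr_gt0 // ler_nat ltnn.
Qed.

(** * Determinants of polynomials in a matrix, and the companion matrix *)

Lemma eigenvalue_det (F : fieldType) n (D : 'M[F]_n.+1) (b : F) :
  eigenvalue D b = (\det (D - b%:M) == 0).
Proof.
apply/eigenvalueP/det0P => [[v Ev v0]|[v v0 Ev]]; exists v => //.
  by rewrite mulmxBr Ev mul_mx_scalar subrr.
by apply/eqP; rewrite -subr_eq0 -mul_mx_scalar -mulmxBr Ev.
Qed.

(** The determinant acts as a resultant of [q] and the characteristic polynomial of [D]: splitting
    [q] into linear factors turns it into a product of factors [\det (D - b%:M)]. *)
Lemma det_horner_mx_eq0 (C : numClosedFieldType) n (D : 'M[C]_n.+1) (q : {poly C}) :
  \det (horner_mx D q) = 0 <-> exists2 b, eigenvalue D b & root q b.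
Proof.
split=> [|[b]].
  (* For [q = 0] any eigenvalue is a witness, and one exists over a closed field. *)
  have [->|q0] := eqVneq q 0.
    by have [b Db] := eigenvalue_closed D (ltn0Sn n) => _; exists b; rewrite ?root0.
  have [s Es] := closed_field_poly_normal q.
  have l0 : lead_coef q != 0 by rewrite lead_coef_eq0.
  rewrite Es linearZ /= detZ rmorph_prod /= => /eqP.
  rewrite mulf_eq0 expf_eq0 (negPf l0) andbF /= => H.
  suff [b bs Hb] : exists2 b, b \in s & eigenvalue D b.
    by exists b; rewrite // rootZ // root_prod_XsubC.
  elim: s {Es} H => [|b s IH]; first by rewrite big_nil det1 oner_eq0.
  rewrite big_cons det_mulmx mulf_eq0 rmorphB /= horner_mx_X horner_mx_C.
  case/orP=> [H|/IH [c cs Hc]]; last by exists c; rewrite // inE cs orbT.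
  by exists b; rewrite ?inE ?eqxx // eigenvalue_det.
rewrite eigenvalue_det => /eqP Db /factor_theorem [g ->].
by rewrite rmorphM /= rmorphB /= horner_mx_X horner_mx_C det_mulmx Db mulr0.
Qed.

(* [d] times the companion matrix of [d X^(n+1) + q n X^n + ... + q 0], scaled
   so as to make sense without dividing by [d]. *)
Definition scaled_companion (R : nzRingType) n (d : R) (q : nat -> R) : 'M[R]_n.+1 :=
  \matrix_(i, j) if (j < n)%N then d *+ (i == j.+1 :> nat) else - q i.

(** The first [n] columns force a left eigenvector to be a multiple of [(1, z, ..., z^n)]; the last
    column is then the polynomial equation. *)
Lemma eigenvalue_scaled_companion (F : fieldType) n (d : F) (q : nat -> F) (z : F) :
  d != 0 ->
  eigenvalue (scaled_companion n d q) (d * z) =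
    (\sum_(i < n.+1) q i * z ^+ i + d * z ^+ n.+1 == 0).
Proof.
move=> d0; have mulE (v : 'rV[F]_n.+1) j : (v *m scaled_companion n d q) 0 j =
    if (j < n)%N then d * v 0 (inord j.+1) else - \sum_i v 0 i * q i.
  rewrite mxE; case: ifP => jn.
    rewrite (bigD1 (inord j.+1)) //= mxE jn inordK ?ltnS // eqxx mulrC.
    rewrite big1 ?addr0 // => i ij; rewrite mxE jn.
    case: eqP => [E|_]; last by rewrite mulr0n mulr0.
    by case/eqP: ij; apply: val_inj; rewrite /= inordK ?ltnS.
  by rewrite -sumrN; apply: eq_bigr => i _; rewrite mxE jn mulrN.
apply/eigenvalueP/eqP => [[v Ev v0]|Ez].
  have vE k : (k <= n)%N -> v 0 (inord k) = v 0 0 * z ^+ k.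
    elim: k => [|k IH] kn.
      by rewrite expr0 mulr1; congr (v 0 _); apply: val_inj; rewrite /= inordK.
    have := congr1 (fun w : 'rV_n.+1 => w 0 (inord k)) Ev.
    rewrite mulE inordK ?ltnS ?(ltnW kn) // kn mxE (IH (ltnW kn)) -mulrA.
    move=> /(mulfI d0) ->.
    by rewrite exprS mulrCA.
  have v00 : v 0 0 != 0.
    apply: contraNneq v0 => v00; apply/eqP/rowP => j.
    by rewrite mxE -[j]inord_val vE ?v00 ?mul0r // -ltnS.
  have := congr1 (fun w : 'rV_n.+1 => w 0 ord_max) Ev.
  rewrite mulE ltnn mxE -[ord_max]inord_val vE //= => E.
  apply: (mulfI v00); rewrite mulr0 mulrDr exprS.
  have -> : v 0 0 * (d * (z * z ^+ n)) = d * z * (v 0 0 * z ^+ n) by ring.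
  rewrite -E mulr_sumr -sumrB big1 // => i _.
  have -> : v 0 i = v 0 0 * z ^+ i by rewrite -vE ?inord_val // -ltnS.
  by ring.
exists (\row_(i < n.+1) z ^+ i); last first.
  by apply/eqP => /rowP/(_ 0)/eqP; rewrite !mxE expr0 oner_eq0.
apply/rowP => j; rewrite mulE 2!mxE; case: ifP => jn.
  by rewrite mxE inordK ?ltnS // exprS mulrA.
rewrite [X in _ = _ * X]mxE.
have -> : j = n :> nat by apply/eqP; rewrite eqn_leq -ltnS ltn_ord leqNgt jn.
rewrite -mulrA -exprS; apply/eqP; rewrite eq_sym -subr_eq0 opprK addrC.
rewrite -[X in _ == X]Ez; apply/eqP; congr (_ + _).
by apply: eq_bigr => i _; rewrite mxE mulrC.
Qed.

(** * The largest slope of the Newton polygon *)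

Lemma max_slope (N : nat) (P : pred nat) (o : nat -> nat) k0 :
  (0 < k0 < N)%N -> P k0 -> (o k0 < o 0)%N ->
  exists kd, [/\ (0 < kd < N)%N, P kd, (o kd < o 0)%N &
    forall k, (0 < k < N)%N -> P k -> ((o 0 - o k) * kd <= (o 0 - o kd) * k)%N].
Proof.
move=> /andP[k00 k0N] Pk0 ok0.
pose Q (i : 'I_N) := (0 < i)%N && P i.
(* Truncated subtraction gives slope 0 to the indices with [o 0 <= o i], so they cannot beat the
   positive slope at [k0]. *)
pose F (i : 'I_N) : rat := (o 0 - o i)%N%:R / i%:R.
have Qi : Q (Ordinal k0N) by rewrite /Q /= k00.
case: (@arg_maxP _ _ _ (Ordinal k0N) Q F Qi) => i /andP[i0 Pi] Hi.
have le k (kN : (k < N)%N) : (0 < k)%N -> P k ->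
    ((o 0 - o k) * i <= (o 0 - o i) * k)%N.
  move=> k1 Pk; have Qk : Q (Ordinal kN) by rewrite /Q /= k1.
  have := Hi _ Qk; rewrite /F /= ler_pdivrMr ?ltr0n // mulrAC ler_pdivlMr ?ltr0n //.
  by rewrite -!natrM ler_nat.
exists (val i); split; rewrite ?i0 ?ltn_ord //.
  have := le _ k0N k00 Pk0; rewrite -subn_gt0 => H.
  have : (0 < (o 0 - o i) * k0)%N.
    by apply: leq_trans H; rewrite muln_gt0 subn_gt0 ok0.
  by rewrite muln_gt0 => /andP[].
by move=> k /andP[k1 kN]; exact: le.
Qed.

(* If the coefficients [r k] of a polynomial with smallest root modulus [mu]
   have size about [x ^+ o k], then [mu] has size about [x ^+ (kn / kd)], the
   largest slope of the Newton polygon. *)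
Lemma smallest_root_newton (C : numClosedFieldType) (N : nat) (o : nat -> nat)
    (r : nat -> C) (B x mu : C) (P : pred nat) kd :
  1 <= B -> 0 < x -> x <= 1 -> 0 <= mu -> P 0%N ->
  (forall k, (k < N)%N -> P k ->
     x ^+ o k <= B * `|r k| /\ `|r k| <= B * x ^+ o k) ->
  (forall k, (k < N)%N -> ~~ P k -> r k = 0) ->
  (forall k, `|r k| * mu ^+ k <= 2 ^+ N * `|r 0%N|) ->
  (exists2 k, (0 < k < N)%N & `|r 0%N| <= N%:R * (`|r k| * mu ^+ k)) ->
  (0 < kd < N)%N -> P kd -> (o kd < o 0)%N ->
  (forall k, (0 < k < N)%N -> P k -> ((o 0 - o k) * kd <= (o 0 - o kd) * k)%N) ->
  x ^+ (o 0 - o kd) <= (B * (N%:R * B)) ^+ kd * mu ^+ kd /\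
  mu ^+ kd <= B * (2 ^+ N * B) * x ^+ (o 0 - o kd).
Proof.
move=> B1 x0 x1 mu0 P0 Hr Hr0 Hub [k /andP[k0 kN] Hk] /andP[kd0 kdN] Pkd okd Hslope.
have B0 : 0 < B by exact: lt_le_trans B1.
have N0 : (0 < N)%N by exact: leq_trans kN.
have [h01 h02] := Hr _ N0 P0.
split; last first.
  have [h1 h2] := Hr _ kdN Pkd.
  rewrite -(ler_pM2l (exprn_gt0 (o kd) x0)) mulrCA -exprD subnKC; last exact: ltnW.
  rewrite (le_trans (ler_wpM2r _ h1)) ?exprn_ge0 // -!mulrA ler_pM2l //.
  rewrite (le_trans (Hub kd)) // ler_wpM2l ?exprn_ge0 //.
(* Otherwise [r k], and with it [r 0], would vanish, against the lower bound for [r 0]. *)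
have Pk : P k.
  apply/negPn/negP => /(Hr0 _ kN) rk; move: Hk; rewrite rk normr0 mul0r mulr0.
  rewrite normr_le0 => /eqP r0; move: h01; rewrite r0 normr0 mulr0.
  by rewrite (lt_geF (exprn_gt0 _ x0)).
have [h1 h2] := Hr _ kN Pk.
set D := B * (N%:R * B).
have D1 : 1 <= D.
  by rewrite mulr_ege1 ?mulr_ege1 ?ler1n.
have D0 : 0 <= D by exact: le_trans D1.
have hD : x ^+ o 0 <= D * mu ^+ k * x ^+ o k.
  rewrite (le_trans h01) // /D -!mulrA ler_pM2l // (le_trans Hk) //.
  rewrite ler_wpM2l // mulrCA [X in X <= _]mulrC.
  by rewrite ler_wpM2l ?exprn_ge0.
clearbody D.
have hD' : x ^+ (o 0 - o k) <= D * mu ^+ k.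
  have [le|/ltnW le] := leqP (o k) (o 0).
    by rewrite -(ler_pM2r (exprn_gt0 (o k) x0)) -exprD subnK.
  (* The truncated exponent is 0 here; [1 <= D * mu ^+ k] still holds since [x <= 1] gives
     [x ^+ o k <= x ^+ o 0]. *)
  have /eqP -> : (o 0 - o k == 0)%N by [].
  rewrite expr0 -(ler_pM2r (exprn_gt0 (o 0) x0)) mul1r (le_trans hD) //.
  apply: ler_wpM2l; first by rewrite mulr_ge0 ?exprn_ge0.
  by rewrite ler_wiXn2l // ltW.
(* The dominant index [k] may differ from [kd]. After raising to the power [k], the slope inequality
   and [x <= 1] carry the bound at [k] over to [kd]; the surplus power of [D] is harmless as
   [1 <= D]. *)
rewrite -(ler_pXn2r k0) ?nnegrE ?mulr_ge0 ?exprn_ge0 ?(ltW x0) //.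
rewrite -exprM (@le_trans _ _ (x ^+ ((o 0 - o k) * kd))) //.
  by rewrite ler_wiXn2l ?(ltW x0) // Hslope ?k0.
rewrite exprM (@le_trans _ _ ((D * mu ^+ k) ^+ kd)) //.
  by apply: lerXn2r => //; rewrite nnegrE ?mulr_ge0 ?exprn_ge0 // ltW.
rewrite !exprMn -!exprM [(k * kd)%N]mulnC ler_wpM2r ?exprn_ge0 //.
by rewrite ler_weXn2l // leq_pmulr.
Qed.

(** * A Harnack estimate and passage to the boundary *)

(** Each root has [|b| >= 1], so [|z - b| >= (1 - |z|) * |b|] while [|z0 - b| <= 2 * |b|]; multiply
    over the roots. The constant depends on [f] only through the degree bound [m]. *)
Lemma harnack_no_roots (C : numClosedFieldType) (f : {poly C}) m (z z0 : C) :
  (size f <= m.+1)%N -> (forall b, `|b| < 1 -> ~~ root f b) ->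
  `|z| < 1 -> `|z0| <= 1 -> ((1 - `|z|) / 2) ^+ m * `|f.[z0]| <= `|f.[z]|.
Proof.
move=> fm nf z1 z01; have [->|f0] := eqVneq f 0.
  by rewrite !horner0 normr0 mulr0.
have [s Es] := closed_field_poly_normal f.
have l0 : lead_coef f != 0 by rewrite lead_coef_eq0.
have szs : (size s <= m)%N.
  rewrite -ltnS (leq_trans _ fm) //.
  by rewrite [X in (_ <= size (polyseq X))%N]Es size_scale // size_prod_XsubC.
have Hs b : b \in s -> 1 <= `|b|.
  move=> bs; rewrite real_leNgt ?ger0_real //; apply/negP => /nf.
  by rewrite Es rootZ // root_prod_XsubC bs.
set c := (1 - `|z|) / 2.
have c0 : 0 <= c by rewrite divr_ge0 // subr_ge0 ltW.
have c1 : c <= 1.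
  rewrite ler_pdivrMr // mul1r (@le_trans _ _ 1) ?ler1n // lerBlDr lerDl //.
apply: le_trans (_ : c ^+ size s * `|f.[z0]| <= _).
  by rewrite ler_wpM2r // ler_wiXn2l.
rewrite Es !hornerZ !normrM mulrCA ler_wpM2l // {Es szs}.
elim: s Hs => [|b s IH] Hs; first by rewrite !big_nil expr0 mul1r !hornerE.
rewrite !big_cons !hornerM !normrM exprS !hornerXsubC mulrACA.
apply: ler_pM; [exact: mulr_ge0 | exact/mulr_ge0/normr_ge0/exprn_ge0 | | ]; last first.
  by apply: IH => d ds; rewrite Hs // inE ds orbT.
have b1 : 1 <= `|b| by rewrite Hs // inE eqxx.
apply: le_trans (_ : (1 - `|z|) / 2 * (2 * `|b|) <= _).
  rewrite ler_wpM2l // (le_trans (ler_normB _ _)) // mulr_natl mulr2n lerD //.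
  exact: le_trans b1.
rewrite mulrA divfK ?pnatr_eq0 // mulrBl mul1r.
rewrite (@le_trans _ _ (`|b| - `|z|)) //.
  by rewrite lerD2l lerN2 ler_peMr.
by rewrite distrC lerB_dist.
Qed.

(** Along the radius [(1 - e) * w] the value of [u] is of order [e], hence so is that of [v], which
    a nonzero [v.[w]] excludes. *)
Lemma root_of_dominated (C : numClosedFieldType) (u v : {poly C}) (c w : C) :
  0 < c -> `|w| = 1 -> (forall x, `|x| < 1 -> c * `|v.[x]| <= `|u.[x]|) ->
  root u w -> root v w.
Proof.
move=> c0 w1 Huv uw; apply/negPn/negP => vw.
have [B B1 HB] := poly_lower_bound_near vw.
have [g Hg] := horner_subr_factor u w.
have [G G1 HG] := poly_bounded_unit_disk g.
have B0 : 0 < B by exact: lt_le_trans B1.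
have G0 : 0 < G by exact: lt_le_trans G1.
have c10 : 0 < 1 + c by rewrite addr_gt0.
(* Small enough for the lower bound on [v] to apply at distance [e], and for
   [B * G * e = c / (2 * (1 + c))] to stay below [c]. *)
pose e := c / (2 * B * G * (1 + c)).
have e0 : 0 < e by rewrite divr_gt0 // !mulr_gt0.
have eB : e < B^-1.
  have -> : e = B^-1 * (c / (2 * G * (1 + c))).
    by rewrite /e; field; rewrite !gt_eqF.
  rewrite -[ltRHS]mulr1 ltr_pM2l ?invr_gt0 // ltr_pdivrMr ?mulr_gt0 // mul1r.
  rewrite (@lt_le_trans _ _ (1 + c)) ?ltrDr // ler_peMl ?(ltW c10) //.
  by rewrite mulr_ege1 // ler1n.
have e1 : e < 1 by rewrite (lt_le_trans eB) // invf_le1.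
have ew : `|1 - e| = 1 - e by rewrite ger0_norm // subr_ge0 ltW.
have x1 : `|(1 - e) * w| < 1 by rewrite normrM w1 mulr1 ew ltrBlDr ltrDl.
have dx : `|(1 - e) * w - w| = e.
  by rewrite mulrBl mul1r addrC addKr normrN normrM w1 mulr1 gtr0_norm.
have hv := HB _ (ltW x1); rewrite dx in hv.
have hu : `|u.[(1 - e) * w]| <= G * e.
  have := Hg ((1 - e) * w); rewrite (rootP uw) subr0 => ->.
  by rewrite normrM dx ler_wpM2r ?HG // ltW.
have : c <= B * (G * e).
  apply: le_trans (_ : c * (B * `|v.[(1 - e) * w]|) <= _).
    by rewrite ler_peMr ?hv // ltW.
  by rewrite mulrCA ler_pM2l // (le_trans (Huv _ x1)).
have -> : B * (G * e) = c * (2 * (1 + c))^-1.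
  by rewrite /e; field; rewrite !gt_eqF.
rewrite ler_pMr // lt_geF // invf_lt1 ?mulr_gt0 //.
by rewrite (@lt_le_trans _ _ (1 + c)) ?ltrDl // ler_peMl ?(ltW c10) ?ler1n.
Qed.

(** The Cayley transforms of the natural numbers are distinct points of the circle; one more of them
    than the length of [L] cannot all lie in [L]. *)
Lemma unit_circle_infinite (C : numClosedFieldType) (L : seq C) :
  exists2 w, `|w| = 1 & w \notin L.
Proof.
pose f (k : nat) : C := (1 + k%:R * 'i) / (1 - k%:R * 'i).
have nz (k : nat) : 1 - k%:R * 'i != 0 :> C.
  rewrite subr_eq0; apply/eqP => /(congr1 (fun x => x ^+ 2)).
  rewrite exprMn sqrCi expr1n mulrN1 => /eqP.
  by rewrite -subr_eq0 opprK gt_eqF // ltr_pwDl // exprn_ge0.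
have f1 k : `|f k| = 1.
  have -> : f k = (1 + k%:R * 'i) / (1 + k%:R * 'i)^*.
    by rewrite /f rmorphD rmorphM /= conjCi rmorph1 rmorph_nat mulrN.
  rewrite normf_div norm_conjC divff // -norm_conjC normr_eq0.
  by rewrite rmorphD rmorphM /= conjCi rmorph1 rmorph_nat mulrN nz.
have finj : injective f.
  move=> j k /eqP; rewrite eqr_div // -subr_eq0.
  have -> : (1 + j%:R * 'i) * (1 - k%:R * 'i) - (1 + k%:R * 'i) * (1 - j%:R * 'i)
      = (j%:R - k%:R) * (2 * 'i) :> C by ring.
  rewrite !mulf_eq0 pnatr_eq0 (negPf (neq0Ci C)) !orbF subr_eq0 => /eqP/eqP.
  by rewrite eqr_nat => /eqP.
case: (boolP (all (mem L) [seq f k | k <- iota 0 (size L).+1])) => [/allP H|].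
  have := uniq_leq_size _ H; rewrite map_inj_uniq // iota_uniq size_map size_iota.
  by move=> /(_ isT); rewrite ltnn.
case/allPn => w /mapP [k _ ->] H; exists (f k) => //.
Qed.

(** * Bivariate polynomials, their reflection, and the gap polynomial *)

Definition zcoef (C : numClosedFieldType) n (a : nat -> nat -> C) i : {poly C} :=
  \poly_(j < n.+1) a i j.

Definition biv (C : numClosedFieldType) m n (a : nat -> nat -> C) (z w : C) : C :=
  \sum_(i < m.+1) (zcoef n a i).[w] * z ^+ i.

(** The homogenisation in the first variable. For [w] on the circle it is, up to a monomial, the
    conjugate of the reflection at [(y / z)^*], but it also makes sense at [z = 0]. *)
Definition hbiv (C : numClosedFieldType) m n (a : nat -> nat -> C) (w y z : C) : C :=
  \sum_(i < m.+1) (zcoef n a i).[w] * y ^+ (m - i) * z ^+ i.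

Definition breflect (C : numClosedFieldType) m n (a : nat -> nat -> C) i j : C :=
  (a (m - i)%N (n - j)%N)^*.

Lemma horner_zcoef_breflect (C : numClosedFieldType) m n (a : nat -> nat -> C) (w : C) i :
  `|w| = 1 ->
  (zcoef n (breflect m n a) i).[w] = w ^+ n * ((zcoef n a (m - i)).[w])^*.
Proof.
move=> w1; have ww : w * w^* = 1 by rewrite -normCK w1 expr1n.
rewrite !horner_poly rmorph_sum mulr_sumr (reindex_inj rev_ord_inj) /=.
apply: eq_bigr => j _; have jn : (j <= n)%N by rewrite -ltnS.
rewrite /breflect subSS subKn // rmorphM rmorphXn /=.
rewrite -[in w ^+ n](subnK jn) exprD.
have -> : w ^+ (n - j) * w ^+ j * ((a (m - i)%N j)^* * w^* ^+ j) =
   (a (m - i)%N j)^* * w ^+ (n - j) * (w * w^*) ^+ j by rewrite exprMn; ring.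
by rewrite ww expr1n mulr1.
Qed.

Lemma hbiv_breflect (C : numClosedFieldType) m n (a : nat -> nat -> C) (w y z : C) :
  `|w| = 1 -> z != 0 ->
  hbiv m n a w y z = w ^+ n * z ^+ m * (biv m n (breflect m n a) (y / z)^* w)^*.
Proof.
move=> w1 z0; have ww : w * w^* = 1 by rewrite -normCK w1 expr1n.
rewrite /biv rmorph_sum mulr_sumr /hbiv (reindex_inj rev_ord_inj) /=.
apply: eq_bigr => i _; have im : (i <= m)%N by rewrite -ltnS.
rewrite subSS subKn // horner_zcoef_breflect //.
have -> c t : (w ^+ n * c^* * t^* ^+ i)^* = w^* ^+ n * c * t ^+ i.
  by rewrite !rmorphM !rmorphXn /= !conjCK.
rewrite exprMn exprVn -[in z ^+ m](subnK im) exprD.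
have -> : w ^+ n * (z ^+ (m - i) * z ^+ i) * (w^* ^+ n * (zcoef n a (m - i)).[w] *
   (y ^+ i / z ^+ i)) = (w * w^*) ^+ n * ((zcoef n a (m - i)).[w] * y ^+ i * z ^+ (m - i)).
  by rewrite exprMn; field; rewrite expf_neq0.
by rewrite ww expr1n mul1r.
Qed.

Lemma hbiv1 (C : numClosedFieldType) m n (a : nat -> nat -> C) (w z : C) :
  hbiv m n a w 1 z = biv m n a z w.
Proof. by apply: eq_bigr => i _; rewrite expr1n mulr1. Qed.

Lemma hbiv0r (C : numClosedFieldType) m n (a : nat -> nat -> C) (w y : C) :
  hbiv m n a w y 0 = (zcoef n a 0).[w] * y ^+ m.
Proof.
rewrite /hbiv big_ord_recl big1 ?addr0 => [|i _]; last by rewrite expr0n mulr0.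
by rewrite expr0 mulr1 subn0.
Qed.

Lemma bivr0 (C : numClosedFieldType) m n (a : nat -> nat -> C) (w : C) :
  biv m n a 0 w = (zcoef n a 0).[w].
Proof. by rewrite -hbiv1 hbiv0r expr1n mulr1. Qed.

(* For [`|w| = 1] its roots in the outer variable [s] are the numbers
   [1 - z * z'^*], where [z] and [z'] are zeros of the reflection at [w]. *)
Definition gap_poly (C : numClosedFieldType) m n (a : nat -> nat -> C) : {poly {poly C}} :=
  let lc := zcoef n (breflect m.+1 n a) m.+1 in
  \det (horner_mx
    (scaled_companion m lc%:P (fun i => (zcoef n (breflect m.+1 n a) i)%:P))
    (\poly_(i < m.+2) ((1 - 'X) ^+ (m.+1 - i) * (zcoef n a i * lc ^+ (m.+1 - i))%:P))).

(** Specialising both variables commutes with the determinant, so a root means that the homogenised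
    polynomial shares a zero with the reflection. *)
Lemma root_gap_poly (C : numClosedFieldType) m n (a : nat -> nat -> C) (w s : C) :
  (zcoef n (breflect m.+1 n a) m.+1).[w] != 0 ->
  root (map_poly (horner_eval w) (gap_poly m n a)) s <->
  exists2 z, biv m.+1 n (breflect m.+1 n a) z w = 0 & hbiv m.+1 n a w (1 - s) z = 0.
Proof.
set lc := zcoef n (breflect m.+1 n a) m.+1 => lc0.
have [rho [rhoC rhoX rhoE]] : exists rho : {rmorphism {poly {poly C}} -> C},
    [/\ forall q, rho q%:P = q.[w], rho 'X = s &
      forall q, root (map_poly (horner_eval w) q) s = (rho q == 0)].
  exists (horner_eval s \o map_poly (horner_eval w))%FUN; split=> //= [q|].
    by rewrite map_polyC /= /horner_eval hornerC.
  by rewrite map_polyX /horner_eval hornerX.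
rewrite rhoE /gap_poly -/lc -det_map_mx map_horner_mx.
have -> : map_mx rho (scaled_companion m lc%:P
     (fun i => (zcoef n (breflect m.+1 n a) i)%:P)) =
   scaled_companion m lc.[w] (fun i => (zcoef n (breflect m.+1 n a) i).[w]).
  apply/matrixP => i j; rewrite !mxE; case: ifP => _.
    by rewrite rmorphMn /= rhoC.
  by rewrite rmorphN /= rhoC.
set q := map_poly _ _.
(* The eigenvalues of the scaled companion matrix are [lc.[w] * z]; the powers of [lc] in [gap_poly]
   compensate for this scaling. *)
have qE z : q.[lc.[w] * z] = lc.[w] ^+ m.+1 * hbiv m.+1 n a w (1 - s) z.
  have -> : q = \poly_(i < m.+2)
      ((1 - s) ^+ (m.+1 - i) * ((zcoef n a i).[w] * lc.[w] ^+ (m.+1 - i))).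
    apply/polyP => i; rewrite coef_map !coef_poly /=; case: ifP => _.
      by rewrite rmorphM rmorphXn rmorphB rmorph1 /= rhoX rhoC !hornerE.
    by rewrite rmorph0.
  rewrite horner_poly mulr_sumr.
  apply: eq_bigr => i _; have im : (i <= m.+1)%N by rewrite -ltnS.
  rewrite exprMn -[in lc.[w] ^+ m.+1](subnK im) exprD.
  by ring.
split=> [/eqP/det_horner_mx_eq0 [b]|[z Ez Hz]].
  have -> : b = lc.[w] * (b / lc.[w]) by rewrite mulrC divfK.
  rewrite eigenvalue_scaled_companion // => /eqP Eb.
  rewrite rootE qE mulf_eq0 expf_eq0 (negPf lc0) andbF /= => /eqP Hb.
  by exists (b / lc.[w]); rewrite // /biv big_ord_recr.
apply/eqP/det_horner_mx_eq0; exists (lc.[w] * z).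
  by rewrite eigenvalue_scaled_companion //; move: Ez; rewrite /biv big_ord_recr => /eqP.
by rewrite rootE qE Hz mulr0.
Qed.

Lemma zcoef_breflect_lead (C : numClosedFieldType) m n (a : nat -> nat -> C) (w : C) :
  `|w| = 1 -> (zcoef n a 0).[w] != 0 -> (zcoef n (breflect m n a) m).[w] != 0.
Proof.
move=> w1 a0; rewrite horner_zcoef_breflect // subnn mulf_neq0 ?fmorph_eq0 //.
by rewrite expf_neq0 // -normr_gt0 w1.
Qed.

Lemma root_gap_polyP (C : numClosedFieldType) m n (a : nat -> nat -> C) (w s : C) :
  `|w| = 1 -> (zcoef n a 0).[w] != 0 ->
  root (map_poly (horner_eval w) (gap_poly m n a)) s ->
  exists z z', [/\ biv m.+1 n (breflect m.+1 n a) z w = 0,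
    biv m.+1 n (breflect m.+1 n a) z' w = 0 & s = 1 - z * z'^*].
Proof.
move=> w1 a0 /(root_gap_poly _ (zcoef_breflect_lead _ w1 a0)) [z Ez].
(* If [z = 0], only [s = 1] is possible and [z' = 0] serves; otherwise [z'] is the conjugate of
   [(1 - s) / z]. *)
have [z0|z0] := eqVneq z 0.
  rewrite z0 in Ez *; rewrite hbiv0r => /eqP; rewrite mulf_eq0 (negPf a0) expf_eq0 /= subr_eq0.
  by move/eqP => <-; exists 0, 0; rewrite mul0r subr0.
rewrite hbiv_breflect // => /eqP; rewrite !mulf_eq0 !expf_eq0 (negPf z0) andbF.
rewrite -[w == 0]normr_eq0 w1 oner_eq0 andbF /= fmorph_eq0 => /eqP H.
exists z, ((1 - s) / z)^*; split=> //.
by rewrite conjCK mulrC divfK // opprB addrC subrK.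
Qed.

(** The diagonal pair [z' = z], which yields the smallest gap when [|z|] is maximal. *)
Lemma gap_poly_root (C : numClosedFieldType) m n (a : nat -> nat -> C) (w z : C) :
  `|w| = 1 -> (zcoef n a 0).[w] != 0 -> biv m.+1 n (breflect m.+1 n a) z w = 0 ->
  root (map_poly (horner_eval w) (gap_poly m n a)) (1 - `|z| ^+ 2).
Proof.
move=> w1 a0 Ez; apply/(root_gap_poly _ (zcoef_breflect_lead _ w1 a0)).
exists z; rewrite // opprB addrC subrK; have [->|z0] := eqVneq z 0.
  by rewrite hbiv0r normr0 expr0n expr0n mulr0.
rewrite hbiv_breflect // normCK [z * _]mulrC mulfK // conjCK Ez.
by rewrite conjC0 mulr0.
Qed.

(** * Location of the zeros over the unit circle *)

Lemma biv_circle_zero (C : numClosedFieldType) m n (a : nat -> nat -> C) (z w : C) :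
  `|z| = 1 -> `|w| = 1 ->
  biv m n (breflect m n a) z w = 0 <-> biv m n a z w = 0.
Proof.
move=> z1 w1; have z0 : z != 0 by rewrite -normr_gt0 z1.
have w0 : w != 0 by rewrite -normr_gt0 w1.
rewrite -[biv m n a z w]hbiv1 hbiv_breflect //.
have -> : (1 / z)^* = z by rewrite mul1r invC_norm z1 expr1n invr1 mul1r conjCK.
split=> [->|/eqP]; first by rewrite conjC0 mulr0.
by rewrite !mulf_eq0 !expf_eq0 (negPf z0) (negPf w0) !andbF /= fmorph_eq0 => /eqP.
Qed.

(** A zero outside the closed disk would be reflected to the zero [(z^-1)^*] inside the open
    disk. *)
Lemma breflect_zero_disk (C : numClosedFieldType) m n (a : nat -> nat -> C) (w z : C) :
  `|w| = 1 -> (forall x, `|x| < 1 -> biv m n a x w != 0) ->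
  biv m n (breflect m n a) z w = 0 -> `|z| <= 1.
Proof.
move=> w1 H Ez; rewrite real_leNgt ?ger0_real //; apply/negP => z1.
have z0 : z != 0 by rewrite -normr_gt0 (lt_trans _ z1).
have : biv m n a (z^-1)^* w != 0.
  by apply: H; rewrite norm_conjC normfV invf_lt1 ?normr_gt0.
rewrite -hbiv1 hbiv_breflect ?fmorph_eq0 ?invr_eq0 //.
by rewrite mul1r -fmorphV /= conjCK invrK Ez conjC0 mulr0 eqxx.
Qed.

Lemma exists_max_norm (C : numClosedFieldType) (s : seq C) :
  s != [::] -> exists2 z, z \in s & forall y, y \in s -> `|y| <= `|z|.
Proof.
elim: s => [//|x s IH] _; have [->|s0] := eqVneq s [::].
  by exists x; rewrite ?inE // => y; rewrite inE => /eqP ->.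
have [z zs Hz] := IH s0.
have /orP[le|le] := real_leVge (normr_real x) (normr_real z).
  exists z; first by rewrite inE zs orbT.
  by move=> y; rewrite inE => /orP[/eqP ->|/Hz].
exists x; first by rewrite inE eqxx.
by move=> y; rewrite inE => /orP[/eqP ->|/Hz H] //; exact: le_trans le.
Qed.

(** The Harnack estimate in the first variable, uniform over [|x| < 1], bounds the value at
    [(z0, x)] by that at [(z, x)]. Letting [x] tend radially to [w], a zero at [(z, w)] forces one
    at [(z0, w)], for [z0] chosen to exclude it. *)
Lemma biv_no_zero_boundary (C : numClosedFieldType) m n (a : nat -> nat -> C) :
  (forall z w, `|z| < 1 -> `|w| < 1 -> biv m n a z w != 0) ->
  (forall w, `|w| = 1 -> exists2 z, `|z| = 1 & biv m n a z w != 0) ->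
  forall z w, `|z| < 1 -> `|w| = 1 -> biv m n a z w != 0.
Proof.
move=> H Hline z w z1 w1; have [z0 z01 Hz0] := Hline w w1.
pose u x : {poly C} := \sum_(i < m.+1) zcoef n a i * (x ^+ i)%:P.
have uE x y : (u x).[y] = biv m n a x y.
  by rewrite horner_sum; apply: eq_bigr => i _; rewrite !hornerE.
apply: contraNneq Hz0; rewrite -!uE => /eqP uz.
apply: (@root_of_dominated _ (u z) (u z0) (((1 - `|z|) / 2) ^+ m)) w1 _ uz.
  by rewrite exprn_gt0 // divr_gt0 // subr_gt0.
move=> x x1; pose f := \poly_(i < m.+1) (zcoef n a i).[x].
have fE y : f.[y] = biv m n a y x by rewrite horner_poly.
rewrite !uE -!fE harnack_no_roots ?size_poly ?z01 //.
by move=> b b1; rewrite rootE fE H.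
Qed.

Lemma size_map_poly_horner_eval (C : numClosedFieldType) (w : C) (q : {poly {poly C}}) :
  (size (map_poly (horner_eval w) q) <= size q)%N.
Proof. by rewrite (leq_trans (size_poly _ _)). Qed.

(** * The power law over a closed field *)

(** Integer powers on both sides encode the exponent [kn / kd] without real powers; [c] is at once
    comparison constant and inverse radius. *)
Lemma closest_zero_power_law (C : numClosedFieldType) m n (a : nat -> nat -> C)
    (L : seq (C * C)) (t1 tau : C) :
  (forall z w, `|z| < 1 -> `|w| < 1 -> biv m n a z w != 0) ->
  (forall z w, `|z| = 1 -> `|w| = 1 -> biv m n a z w = 0 -> (z, w) \in L) ->
  `|t1| = 1 -> `|tau| = 1 -> biv m n a t1 tau = 0 ->
  exists kn kd (c : C), [/\ (0 < kn)%N, (0 < kd)%N, 0 < c &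
  forall w, `|w| = 1 -> w != tau -> `|tau - w| < c^-1 ->
    (forall z, `|z| = 1 -> biv m n a z w != 0) /\
    exists z, [/\ biv m n (breflect m n a) z w = 0, `|z| <= 1,
      forall y, biv m n (breflect m n a) y w = 0 -> `|y| <= `|z|,
      `|tau - w| ^+ kn <= c * (1 - `|z|) ^+ kd &
      (1 - `|z|) ^+ kd <= c * `|tau - w| ^+ kn]].
Proof.
move=> Hdisk HL t11 tau1 Ht1.
have Hline w : `|w| = 1 -> exists2 z, `|z| = 1 & biv m n a z w != 0.
  move=> w1; have [z z1 zL] := unit_circle_infinite [seq zw.1 | zw <- L].
  exists z => //; apply: contraNneq zL => E.
  by apply/mapP; exists (z, w); rewrite ?HL.
(* In degree 0 the first variable is absent, so a zero over [tau] would fill a whole circle. *)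
case: m Hdisk HL Ht1 Hline => [|m] Hdisk HL Ht1 Hline.
  have [z z1] := Hline tau tau1.
  by move: Ht1; rewrite /biv !big_ord1 !expr0 => ->; rewrite eqxx.
have Hbd := biv_no_zero_boundary Hdisk Hline.
have a0 w : `|w| = 1 -> (zcoef n a 0).[w] != 0.
  by move=> w1; rewrite -(bivr0 m.+1) Hbd ?normr0.
have Hle w z : `|w| = 1 -> biv m.+1 n (breflect m.+1 n a) z w = 0 -> `|z| <= 1.
  by move=> w1; apply: breflect_zero_disk => // x x1; exact: Hbd.
set R := gap_poly m n a.
have coefR w k : (map_poly (horner_eval w) R)`_k = (R`_k).[w] by rewrite coef_map.
(* A root [s = 0] means [z * z'^* = 1] with both zeros in the closed disk, so both lie on the
   circle. *)
have R0 w : `|w| = 1 -> root R`_0 w -> exists2 z, `|z| = 1 & biv m.+1 n a z w = 0.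
  move=> w1; rewrite rootE -coefR -horner_coef0 => H.
  have [z [z' [Ez Ez' Ezz]]] := root_gap_polyP w1 (a0 _ w1) H.
  have z1 : `|z| = 1.
    apply/le_anti; rewrite (Hle _ _ w1 Ez) /=.
    have /eqP : 1 = z * z'^* by apply/eqP; rewrite -subr_eq0 -Ezz.
    move/eqP/(congr1 Num.norm); rewrite normr1 normrM norm_conjC => ->.
    by rewrite ler_piMr // (Hle _ _ w1 Ez').
  by exists z => //; apply/biv_circle_zero.
have R0tau : root R`_0 tau.
  have /(biv_circle_zero _ _ _ t11 tau1) E := Ht1.
  have := gap_poly_root tau1 (a0 _ tau1) E.
  by rewrite t11 expr1n subrr rootE horner_coef0 coefR.
have R0n0 : R`_0 != 0.
  have [w w1 wL] := unit_circle_infinite [seq zw.2 | zw <- L].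
  apply: contraNneq wL => E.
  have [|z z1 Ez] := R0 w w1; first by rewrite E root0.
  by apply/mapP; exists (z, w); rewrite ?HL.
(* If all coefficients vanished at [tau], every number would be a root there; but roots have the
   form [1 - z * z'^*] and modulus at most 2, which excludes 3. *)
have [k0 k0N Rk0] : exists2 k0, (k0 < size R)%N & ~~ root R`_k0 tau.
  have [[k Hk]|] := altP (@existsP _ (fun k : 'I_(size R) => ~~ root R`_k tau)).
    by exists k.
  rewrite negb_exists => /forallP H.
  have : root (map_poly (horner_eval tau) R) 3.
    suff -> : map_poly (horner_eval tau) R = 0 by rewrite root0.
    apply/polyP => k; rewrite coefR coef0.
    have [kN|kN] := ltnP k (size R); last by rewrite nth_default // horner0.
    by apply/eqP; have := H (Ordinal kN); rewrite negbK.
  move/(root_gap_polyP tau1 (a0 _ tau1)) => [z [z' [Ez Ez' Ezz]]].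
  have : `|3 : C| <= 2.
    rewrite Ezz (le_trans (ler_normB _ _)) // normr1 normrM norm_conjC.
    by rewrite lerD2l mulr_ile1 ?(Hle _ _ tau1).
  by rewrite normr_nat ler_nat.
pose o k := mup tau R`_k.
have o0 : (0 < o 0%N)%N by rewrite -XsubC_dvd // dvdp_XsubCl.
have ok0 : o k0 = 0%N by rewrite /o mupNroot.
have k00 : (0 < k0)%N by rewrite lt0n; apply: contraNneq Rk0 => ->.
have Pk0 : R`_k0 != 0 by apply: contraNneq Rk0 => ->; rewrite root0.
have [kd [kdN Pkd okd Hslope]] : exists kd, [/\ (0 < kd < size R)%N, R`_kd != 0,
    (o kd < o 0)%N & forall k, (0 < k < size R)%N -> R`_k != 0 ->
      ((o 0 - o k) * kd <= (o 0 - o kd) * k)%N].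
  by apply: (@max_slope (size R) (fun k => R`_k != 0) o k0); rewrite ?k00 ?ok0.
have [B B1 HB] := polys_comparable_near R tau.
have B0 : 0 < B by exact: lt_le_trans B1.
have N0 : (0 < size R)%N by exact: leq_trans k0N.
pose c1 := (B * ((size R)%:R * B)) ^+ kd; pose c2 := B * (2 ^+ size R * B).
have c10 : 0 < c1 by rewrite exprn_gt0 // !mulr_gt0 // ltr0n.
have c20 : 0 < c2 by rewrite !mulr_gt0 // exprn_gt0.
(* [B] keeps the radius within that of the coefficient estimates, [c1] and [c2] come from the Newton
   polygon bounds, and [2 ^+ kd] pays for [mu <= 2 * (1 - |z|)]. *)
exists (o 0%N - o kd)%N, kd, (B + c1 * 2 ^+ kd + c2).
have cB : 0 < B + c1 * 2 ^+ kd + c2 by rewrite !addr_gt0 // mulr_gt0 // exprn_gt0.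
split; rewrite ?subn_gt0 //; first by case/andP: kdN.
move=> w w1 wtau wc.
have wB : `|w - tau| < B^-1.
  rewrite distrC (lt_le_trans wc) // lef_pV2 // -addrA lerDl.
  by rewrite ltW // addr_gt0 // mulr_gt0 // exprn_gt0.
have x0 : 0 < `|w - tau| by rewrite normr_gt0 subr_eq0.
have x1 : `|w - tau| <= 1 by rewrite (le_trans (ltW wB)) // invf_le1.
have R0w : ~~ root R`_0 w.
  have wle : `|w| <= 1 by rewrite w1.
  have [h _] := HB _ w (mem_nth 0 N0) R0n0 wle wB.
  apply/negP => /rootP E; move: h.
  by rewrite E normr0 mulr0 (lt_geF (exprn_gt0 _ x0)).
have Hnz z : `|z| = 1 -> biv m.+1 n a z w != 0.
  move=> z1; apply: contraNneq R0w => /(biv_circle_zero _ _ _ z1 w1) E.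
  have := gap_poly_root w1 (a0 _ w1) E.
  by rewrite z1 expr1n subrr rootE horner_coef0 coefR.
split=> //.
pose f := \poly_(i < m.+2) (zcoef n (breflect m.+1 n a) i).[w].
have fE y : f.[y] = biv m.+1 n (breflect m.+1 n a) y w by rewrite horner_poly.
(* The leading coefficient does not vanish at [w], so the degree is positive and a zero exists. *)
have szf : size f = m.+2.
  by rewrite size_poly_eq // (zcoef_breflect_lead _ w1 (a0 _ w1)).
have [s Es] := closed_field_poly_normal f.
have f0 : lead_coef f != 0 by rewrite lead_coef_eq0 -size_poly_eq0 szf.
have sP y : biv m.+1 n (breflect m.+1 n a) y w = 0 <-> y \in s.
  by rewrite -fE -root_prod_XsubC -(rootZ _ _ f0) -Es; split=> /rootP.
have s0 : s != [::].
  apply/eqP => s0; move: szf; rewrite Es s0 big_nil size_scale // size_poly1.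
  by [].
have [z /sP Ez Hz] := exists_max_norm s0.
have {}Hz y : biv m.+1 n (breflect m.+1 n a) y w = 0 -> `|y| <= `|z|.
  by move/sP; exact: Hz.
have z1 := Hle _ _ w1 Ez.
have z2 : 0 <= 1 - `|z| by rewrite subr_ge0.
pose mu := 1 - `|z| ^+ 2.
have muE : mu = (1 + `|z|) * (1 - `|z|) by rewrite /mu; ring.
have mu_ge : 1 - `|z| <= mu by rewrite muE ler_peMl // lerDl.
have mu_le : mu <= 2 * (1 - `|z|) by rewrite muE ler_wpM2r // lerD2l.
have mu0 : 0 <= mu by exact: le_trans mu_ge.
have szR := size_map_poly_horner_eval w R.
have mu_root : root (map_poly (horner_eval w) R) mu by apply: gap_poly_root => //; exact: a0.
(* Both zeros have modulus at most [|z|], so [|1 - y * y'^*|] is at least [1 - |z| ^+ 2]. *)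
have mu_min s' : root (map_poly (horner_eval w) R) s' -> mu <= `|s'|.
  move/(root_gap_polyP w1 (a0 _ w1)) => [y [y' [Ey Ey' ->]]].
  rewrite (le_trans _ (lerB_dist _ _)) // normr1 lerD2l lerN2.
  by rewrite normrM norm_conjC expr2 ler_pM // Hz.
have [] := @smallest_root_newton C (size R) o (fun k => (R`_k).[w]) B
  `|w - tau| mu (fun k => R`_k != 0) kd B1 x0 x1 mu0 R0n0.
- by move=> k kN Pk; apply: HB; rewrite ?mem_nth ?w1.
- by move=> k _; rewrite negbK => /eqP ->; rewrite horner0.
- by move=> k; rewrite -!coefR; exact: coef_bound_of_roots.
- have [|k kN Hk] := root_dominant_coef mu_root _ szR; first by rewrite coefR.
  by exists k => //; move: Hk; rewrite !coefR (ger0_norm mu0).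
- by [].
- by [].
- by [].
- by [].
rewrite -/c1 -/c2 distrC => h1 h2; exists z; split=> //.
  rewrite (le_trans h1) // (@le_trans _ _ (c1 * (2 * (1 - `|z|)) ^+ kd)) //.
    by rewrite ler_pM2l // lerXn2r // nnegrE // mulr_ge0.
  rewrite exprMn mulrA ler_wpM2r ?exprn_ge0 // addrAC lerDr addr_ge0 // ltW //.
rewrite (@le_trans _ _ (mu ^+ kd)) ?lerXn2r ?nnegrE // (le_trans h2) //.
by rewrite ler_wpM2r ?exprn_ge0 // lerDr ltW // addr_gt0 // mulr_gt0 // exprn_gt0.
Qed.

(** * Transfer to pairs of real numbers *)

Definition toC (z : Cx) : R[i] := Complex (Cre z) (Cim z).
Definition fromC (z : R[i]) : Cx := (complex.Re z, complex.Im z).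

Lemma toCK (z : R[i]) : toC (fromC z) = z.
Proof. by case: z. Qed.

Lemma toC_inj : injective toC.
Proof. by case=> [x y] [x' y'] [/= -> ->]. Qed.

Lemma norm_toC z : `|toC z| = ((Cmod z)%:C)%C.
Proof. by rewrite normc_def /Cmod RsqrtE !RpowE. Qed.

Lemma toC_Csub z w : toC (Csub z w) = toC z - toC w.
Proof. by []. Qed.

Lemma toC_Cpow z k : toC (Cpow z k) = toC z ^+ k.
Proof. by elim: k => [|k IH] //; rewrite exprS -IH. Qed.

Lemma toC_Csum k f : toC (Csum k f) = \sum_(i < k.+1) toC (f i).
Proof. by elim: k => [|k IH]; rewrite ?big_ord1 // big_ord_recr -IH. Qed.

Definition toC2 (a : coef2) (i j : nat) : R[i] := toC (a i j).

Lemma toC_peval m n a z w :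
  toC (peval m n a z w) = biv m n (toC2 a) (toC z) (toC w).
Proof.
rewrite toC_Csum; apply: eq_bigr => i _.
rewrite toC_Csum horner_poly mulr_suml; apply: eq_bigr => j _.
by rewrite -!toC_Cpow [X in _ = X]mulrAC -mulrA.
Qed.

Lemma toC_peval_reflect2 m n a z w :
  toC (peval m n (reflect2 m n a) z w) = biv m n (breflect m n (toC2 a)) (toC z) (toC w).
Proof. by rewrite toC_peval. Qed.

Lemma peval_eq0 m n a z w :
  peval m n a z w = C0 <-> biv m n (toC2 a) (toC z) (toC w) = 0.
Proof. by rewrite -toC_peval; split=> [->|/(@toC_inj _ C0)]. Qed.

Lemma closest_zero_power_law_Cx m n a tau :
  no_zeros_in_bidisk m n a -> finitely_many_torus_zeros m n a ->
  is_sing_z2 m n a tau ->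
  exists (kn kd : nat) (c : R),
  [/\ lt 0 kn, lt 0 kd, Rlt R0 c &
  forall w, Cmod w = R1 -> w <> tau -> Rlt (Cmod (Csub tau w)) (Rinv c) ->
    Rlt R0 (Cmod (Csub tau w)) /\ ~ is_sing_z2 m n a w /\
    exists z, [/\ peval m n (reflect2 m n a) z w = C0, Rle (Cmod z) R1,
      forall y, peval m n (reflect2 m n a) y w = C0 -> Rle (Cmod y) (Cmod z),
      Rle (pow (Cmod (Csub tau w)) kn) (Rmult c (pow (Rminus R1 (Cmod z)) kd)) &
      Rle (pow (Rminus R1 (Cmod z)) kd) (Rmult c (pow (Cmod (Csub tau w)) kn))]].
Proof.
move=> Hdisk [L HL] [tau1 [t1 [t11 Ht1]]].
have norm1 z : `|toC z| = 1 <-> Cmod z = R1.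
  by rewrite norm_toC; split=> [[]|->].
have norm_lt1 z : `|toC z| < 1 <-> Rlt (Cmod z) R1.
  by rewrite norm_toC (ltcR _ 1); split=> /RltP.
have norm_le y z : `|toC y| <= `|toC z| <-> Rle (Cmod y) (Cmod z).
  by rewrite !norm_toC lecR; split=> /RleP.
have [|||||kn [kd [c [kn0 kd0 c0 H]]]] := @closest_zero_power_law _ m n (toC2 a)
  [seq (toC zw.1, toC zw.2) | zw <- L] (toC t1) (toC tau).
- move=> z w; rewrite -[z]toCK -[w]toCK => /norm_lt1 z1 /norm_lt1 w1.
  by apply/eqP => /peval_eq0; exact: Hdisk.
- move=> z w; rewrite -[z]toCK -[w]toCK => /norm1 z1 /norm1 w1 /peval_eq0.
  move/(HL _ _ z1 w1); elim: L {HL} => [|zw L IH] //= [->|/IH zwL].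
    by rewrite inE eqxx.
  by rewrite inE zwL orbT.
- exact/norm1.
- exact/norm1.
- exact/peval_eq0.
(* In the order on [R[i]], positivity includes being real. *)
have cE : c = ((complex.Re c)%:C)%C.
  by case: c c0 {H} => x y; rewrite ltcE /= => /andP[/eqP ->].
set r := complex.Re c in cE; rewrite {}cE in c0 H.
exists kn, kd, r; split; [exact/ssrnat.ltP | exact/ssrnat.ltP | by apply/RltP; rewrite -ltcR | ].
move=> w w1 wtau /RltP wc.
have wtau' : toC w != toC tau by apply/eqP => /toC_inj.
have [||Hnz [z [Ez z1 Hz h1 h2]]] := H (toC w) _ wtau'; first exact/norm1.
  by rewrite -toC_Csub norm_toC -fmorphV ltcR -RinvE.
split; first by apply/RltP; rewrite -ltcR -norm_toC normr_gt0 toC_Csub subr_eq0 eq_sym.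
split.
  by case=> _ [y [/norm1 y1 /peval_eq0 Ey]]; have := Hnz _ y1; rewrite Ey eqxx.
have nE : 1 - `|toC (fromC z)| = ((Rminus R1 (Cmod (fromC z)))%:C)%C.
  by rewrite norm_toC -rmorphB.
exists (fromC z); rewrite -[z]toCK in Ez z1 Hz h1 h2; split.
- by apply: toC_inj; rewrite toC_peval_reflect2 Ez.
- by apply/RleP; rewrite -lecR -norm_toC.
- by move=> y Ey; apply/norm_le/Hz; rewrite -toC_peval_reflect2 Ey.
- by move: h1; rewrite nE -toC_Csub norm_toC -!rmorphXn -rmorphM lecR -!RpowE => /RleP.
- by move: h2; rewrite nE -toC_Csub norm_toC -!rmorphXn -rmorphM lecR -!RpowE => /RleP.
Qed.

End ClosestZero.

(** * Values of [eps_phi], real powers, and the two-sided estimate *)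

Lemma Cmod_Csub_diag (z : Cx) : Cmod (Csub z z) = 0.
Proof.
  unfold Cmod, Csub, Cre, Cim; simpl.
  rewrite !Rminus_diag, Rmult_0_l, Rplus_0_l.
  exact sqrt_0.
Qed.

Lemma eps_phi_sing (m n : nat) (a : coef2) (w : Cx) :
  is_sing_z2 m n a w -> eps_phi m n a w = 0.
Proof.
  intros Hw.
  assert (H := epsilon_spec (inhabits 0) (fun e =>
    (is_sing_z2 m n a w /\ e = 0) \/ (~ is_sing_z2 m n a w /\ is_min_eps m n a w e))).
  destruct H as [[_ H] | [H _]]; [ | exact H | contradiction].
  exists 0; left; auto.
Qed.

(** A minimum is unique, so the choice operator can only return it. *)
Lemma eps_phi_nonsing (m n : nat) (a : coef2) (w : Cx) (e : R) :
  ~ is_sing_z2 m n a w -> is_min_eps m n a w e -> eps_phi m n a w = e.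
Proof.
  intros Hw He.
  assert (H := epsilon_spec (inhabits 0) (fun e =>
    (is_sing_z2 m n a w /\ e = 0) \/ (~ is_sing_z2 m n a w /\ is_min_eps m n a w e))).
  destruct H as [[H _] | [_ H]]; [exists e; right; auto | contradiction | ].
  fold (eps_phi m n a w) in H.
  destruct H as [[y [Ey ->]] Hy], He as [[z [Ez ->]] Hz].
  apply Rle_antisym; auto.
Qed.

Lemma Rpower_pow_inv (x : R) (k : nat) :
  0 < x -> (0 < k)%nat -> Rpower (x ^ k) (/ INR k) = x.
Proof.
  intros Hx Hk; apply lt_0_INR in Hk; simpl in Hk.
  rewrite <- (Rpower_pow k x Hx), Rpower_mult, Rinv_r, Rpower_1; lra.
Qed.

Lemma Rpower_scaled_pow (x c : R) (kn kd : nat) :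
  0 < x -> 0 < c ->
  Rpower (c * x ^ kn) (/ INR kd) = Rpower c (/ INR kd) * Rpower x (INR kn / INR kd).
Proof.
  intros Hx Hc; unfold Rdiv.
  rewrite <- Rpower_mult, (Rpower_pow kn x Hx), <- Rpower_mult_distr; auto.
  now apply pow_lt.
Qed.

Theorem mainTheorem2 (m n : nat) (a : coef2) (tau2 : Cx) :
  has_bidegree m n a ->
  no_zeros_in_bidisk m n a ->
  atoral m n a ->
  is_sing_z2 m n a tau2 ->
  exists (kn kd : nat), (0 < kn)%nat /\ (0 < kd)%nat /\
  let K := INR kn / INR kd in
  exists c Cc : R, 0 < c /\ c <= Cc /\
  exists delta : R, 0 < delta /\
  forall zeta2 : Cx, Cmod zeta2 = 1 -> Cmod (Csub tau2 zeta2) < delta ->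
    c * rpow (Cmod (Csub tau2 zeta2)) K <= eps_phi m n a zeta2 /\
    eps_phi m n a zeta2 <= Cc * rpow (Cmod (Csub tau2 zeta2)) K.
Proof.
  intros _ Hdisk [Hfin _] Hsing.
  destruct (ClosestZero.closest_zero_power_law_Cx Hdisk Hfin Hsing)
    as (kn & kd & c & [Hkn Hkd Hc H]).
  exists kn, kd; split; [exact Hkn | split; [exact Hkd | intros K]].
  assert (Hk : 0 < / INR kd) by (apply Rinv_0_lt_compat, lt_0_INR; exact Hkd).
  assert (Hc' : 0 < / c) by (apply Rinv_0_lt_compat; exact Hc).
  (* The constants are [kd]-th roots of [/ c] and [c]; the sum in the upper one makes the required
     order between them evident. *)
  exists (Rpower (/ c) (/ INR kd)),
    (Rpower (/ c) (/ INR kd) + Rpower c (/ INR kd)).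
  assert (Hl : 0 < Rpower (/ c) (/ INR kd)) by apply exp_pos.
  assert (Hu : 0 < Rpower c (/ INR kd)) by apply exp_pos.
  split; [exact Hl | split; [lra | ]].
  exists (/ c); split; [exact Hc' | ].
  intros w Hw Hd; unfold rpow.
  destruct (excluded_middle_informative (w = tau2)) as [-> | Hne].
  - rewrite (eps_phi_sing _ _ _ _ Hsing), Cmod_Csub_diag.
    destruct (Rle_dec 0 0); lra.
  - destruct (H w Hw Hne Hd) as [Hx [Hns [z [Ez Hz1 Hmax Hlow Hup]]]].
    rewrite (eps_phi_nonsing m n a w (1 - Cmod z) Hns).
    2:{ split; [exists z; auto | intros y Ey; specialize (Hmax y Ey); lra]. }
    set (x := Cmod (Csub tau2 w)) in *; set (e := 1 - Cmod z) in *.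
    change (x ^ kn <= c * e ^ kd) in Hlow; change (e ^ kd <= c * x ^ kn) in Hup.
    destruct (Rle_dec x 0) as [Hx0 | _]; [lra | ].
    assert (Hxp : 0 < x ^ kn) by (apply pow_lt; exact Hx).
    (* A vanishing [e] would make the positive [x ^ kn] at most 0. *)
    assert (He : 0 < e).
    { destruct (Rle_lt_or_eq_dec 0 e) as [He | He]; [unfold e; lra | exact He | ].
      rewrite <- He, pow_ne_zero in Hlow by (intros ->; inversion Hkd); lra. }
    (* With [e] written as the [kd]-th root of [e ^ kd], both bounds follow from monotonicity of the
       root. *)
    rewrite <- (Rpower_pow_inv e kd He Hkd) at 1 2; unfold K.
    assert (HxK : 0 < Rpower x (INR kn / INR kd)) by apply exp_pos.
    split.
    + rewrite <- (Rpower_scaled_pow x (/ c) kn kd Hx Hc').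
      apply Rle_Rpower_l; [lra | split; [apply Rmult_lt_0_compat; assumption | ]].
      apply (Rmult_le_reg_l c); [exact Hc | ].
      rewrite <- Rmult_assoc, Rinv_r, Rmult_1_l by lra; exact Hlow.
    + apply Rle_trans with (Rpower (c * x ^ kn) (/ INR kd)).
      * apply Rle_Rpower_l; [lra | split; [apply pow_lt; exact He | exact Hup]].
      * rewrite (Rpower_scaled_pow x c kn kd Hx Hc); nra.
Qed.
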